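(* Let $p<q$ be positive coprime integers. Then: (i) if $q\equiv 1 \pmod p$, $S(p,q)=\frac{p^2+q^2+1}{12pq}+\frac{q}{4}-\frac{p}{12}-\frac{1}{6p}-\frac14$; (ii) if $q\equiv 2 \pmod p$, $S(p,q)=\frac{p^2+q^2+1}{12pq}+\frac{q}{4}-\frac{p}{24}-\frac{5}{24p}-\frac14$; (iii) if $q\equiv 3 \pmod p$, $S(p,q)=\frac{p^2+q^2+1}{12pq}+\frac{q}{4}-\frac{p}{36}-\frac{5}{18p}-\frac13\left\{\frac{p}{3}\right\}-\frac{1}{12}$; (iv) if $q\equiv 4 \pmod p$, $S(p,q)=\frac{p^2+q^2+1}{12pq}+\frac{q}{4}-\frac{p}{48}-\frac{17}{48p}-\frac12\left\{\frac{p}{4}\right\}$.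
   Context: For a real number $x$, $\{x\}=x-\lfloor x\rfloor$ denotes the fractional part, where $\lfloor x\rfloor$ is the greatest integer $\le x$. For an integer $p$ and a positive integer $q$, the Dedekind sum is $S(p,q)=\sum_{r=1}^{q-1}\left\{\frac{r}{q}\right\}\left\{\frac{rp}{q}\right\}$. *)

(* Defs.v *)
From mathcomp Require Import all_boot all_order all_algebra.
From mathcomp Require Import reals.

Set Implicit Arguments.
Unset Strict Implicit.
Unset Printing Implicit Defensive.

Import Order.TTheory GRing.Theory Num.Theory.
Local Open Scope ring_scope.

Definition frac_part (R : realType) (x : R) : R := x - (Num.floor x)%:~R.

(* Sum over 1 <= r <= q - 1, without the sawtooth normalization of the
   classical Dedekind sum. Only q > 0 is meaningful. *)
Definition dedekind_sum (R : realType) (p : int) (q : nat) : R :=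
  \sum_(1 <= r < q) frac_part (r%:R / q%:R) * frac_part (r%:R * p%:~R / q%:R).
Arguments dedekind_sum R p q : clear implicits.

(* Main.v *)
(* Reduce S(q, p) to S(c, p), where q = c mod p with c <= 4, by periodicity,
   and then to the finite sum S(p, c) by the reciprocity law
     S(p, q) + S(q, p) = (p^2 + q^2 + 1) / (12 p q) + (p + q) / 4 - 3 / 4.
   For reciprocity, write r p = q f(r) + m(r).  As r |-> m(r) permutes the
   residues mod q, the sums of r and r^2 equal those of m(r) and m(r)^2, which
   yields the sum of f(r) and a relation between those of r f(r) and f(r)^2.
   Counting lattice points below the diagonal of the q x p rectangle with
   weight s relates the sum of f(r)^2 to that of s floor(s q / p). *)
Require Import Defs.
From mathcomp Require Import all_boot all_order all_algebra.
From mathcomp Require Import reals.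
From mathcomp Require Import ring lra zify.

Set Implicit Arguments.
Unset Strict Implicit.
Unset Printing Implicit Defensive.

Import Order.TTheory GRing.Theory Num.Theory.
Local Open Scope ring_scope.

Lemma frac_part_div (R : realType) (n d : nat) : (0 < d)%N ->
  frac_part (n%:R / d%:R : R) = (n %% d)%:R / d%:R.
Proof.
move=> d0; have dR : (d%:R : R) != 0 by rewrite pnatr_eq0 -lt0n.
have E : (n%:R / d%:R : R) = (n %/ d)%:R + (n %% d)%:R / d%:R.
  by rewrite {1}(divn_eq n d) natrD natrM mulrDl mulfK.
rewrite /frac_part; suff -> : Num.floor (n%:R / d%:R : R) = (n %/ d)%:Z.
  by rewrite E addrC addKr.
apply/floor_def; rewrite E intrD !pmulrn mulr1z lerDl ltrD2l.
rewrite divr_ge0 ?ler0n //= ltr_pdivrMr ?ltr0n // mul1r.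
by rewrite -!pmulrn ltr_nat ltn_mod.
Qed.

(** Both fractional parts have denominator [q]. The added term [r = 0] vanishes and makes the range
    a full residue system. *)
Lemma dedekind_sumE (R : realType) (p q : nat) : (0 < q)%N ->
  dedekind_sum R p%:Z q =
  (\sum_(r < q) r * ((r * p) %% q))%:R / q%:R ^+ 2.
Proof.
move=> q0; rewrite /dedekind_sum natr_sum mulr_suml -(big_mkord xpredT
  (fun r => (r * ((r * p) %% q))%:R / q%:R ^+ 2)) [RHS]big_ltn //=.
rewrite mul0n mul0r add0r !big_nat; apply: eq_bigr => r /andP[_ rq].
rewrite -pmulrn -natrM !frac_part_div // (modn_small rq) natrM expr2 invfM.
by ring.
Qed.

(** With the multiplier reduced mod [q], periodicity is immediate and the sum for a small [q] can be
    unrolled residue by residue. *)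
Lemma dedekind_sumE_mod (R : realType) (p q : nat) : (0 < q)%N ->
  dedekind_sum R p%:Z q =
  (\sum_(0 <= r < q) r * ((r * (p %% q)) %% q))%:R / q%:R ^+ 2.
Proof.
move=> q0; rewrite dedekind_sumE // big_mkord; congr (_%:R / _).
by apply: eq_bigr => r _; rewrite modnMmr.
Qed.

Lemma dedekind_sum_mod (R : realType) (q c p : nat) : (0 < p)%N ->
  (q = c %[mod p])%N -> dedekind_sum R q%:Z p = dedekind_sum R c%:Z p.
Proof. by move=> p0 E; rewrite !dedekind_sumE_mod // E. Qed.

(** Multiplication by [p], a unit mod [q], permutes the residues. *)
Lemma sum_perm_mod (V : nmodType) (h : nat -> V) (p q : nat) : coprime p q ->
  \sum_(r < q) h ((r * p) %% q)%N = \sum_(r < q) h r.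
Proof.
case: q => [|q] cop; first by rewrite !big_ord0.
pose m (r : 'I_q.+1) := Ordinal (ltn_pmod (r * p) (ltn0Sn q)).
have mI : injective m.
  move=> r r' /(congr1 val) /= E; apply: val_inj => /=.
  wlog le : r r' E / (r <= r')%N.
    by move=> H; case: (leqP r r') => [|/ltnW] le; [|symmetry]; apply: H.
  move/esym/eqP: E; rewrite eqn_mod_dvd ?leq_mul2r ?le ?orbT // -mulnBl.
  rewrite Gauss_dvdl 1?coprime_sym // -eqn_mod_dvd // !modn_small //.
  by move/eqP.
by rewrite [RHS](reindex_inj mI).
Qed.

Lemma sum_natr (R : numFieldType) (n : nat) :
  \sum_(r < n) r%:R = n%:R * (n%:R - 1) / 2 :> R.
Proof.
elim: n => [|n IH]; first by rewrite big_ord0 !mul0r.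
by rewrite big_ord_recr /= IH -natr1; field.
Qed.

Lemma sum_natr_sqr (R : numFieldType) (n : nat) :
  \sum_(r < n) r%:R ^+ 2 = n%:R * (n%:R - 1) * (2 * n%:R - 1) / 6 :> R.
Proof.
elim: n => [|n IH]; first by rewrite big_ord0 !mul0r.
by rewrite big_ord_recr /= IH -natr1; field.
Qed.

(** Both sides weigh each point [(r, s)] of the [q] by [p] rectangle by [2 * s]. The first sum
    collects, for each [r], the points with [s * q <= r * p]; the second collects, for each [s], the
    remaining ones. *)
Lemma sum_lattice (p q : nat) : (0 < p)%N -> (0 < q)%N -> coprime p q ->
  (\sum_(r < q) (r * p %/ q) * (r * p %/ q).+1
   + 2 * \sum_(s < p) s * (s * q %/ p).+1 = 2 * q * \sum_(s < p) s)%N.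
Proof.
move=> p0 q0 cop.
have tri n : (n * n.+1 = 2 * \sum_(s < n.+1) s)%N.
  by elim: n => [|n IH]; rewrite big_ord_recr ?big_ord0 //= mulnDr -IH; lia.
have quot_lt a b (r : 'I_b) : (0 < a)%N -> (r * a %/ b < a)%N.
  by move=> a0; rewrite ltn_divLR ?ltn_pmul2r // 1?mulnC ?ltn_pmul2l //
    (leq_ltn_trans (leq0n r)).
have -> : (\sum_(r < q) (r * p %/ q) * (r * p %/ q).+1 =
    2 * \sum_(s < p) s * \sum_(r < q | s * q <= r * p) 1)%N.
  under [in RHS]eq_bigr do rewrite big_distrr /=.
  rewrite (exchange_big_dep xpredT) //= big_distrr /=.
  apply: eq_bigr => r _; rewrite tri; congr (2 * _)%N.
  rewrite (big_ord_widen p (fun s => s)) ?quot_lt //.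
  by apply: eq_big => s; rewrite ?muln1 // ltnS leq_divRL.
rewrite -mulnDr -mulnA; congr (2 * _)%N.
rewrite -big_split big_distrr /=; apply: eq_bigr => s _.
(* The row [s = 0] is split off: its count is off by one, because the origin lies on the diagonal,
   but its weight is zero. *)
rewrite -mulnDr mulnC; case: (posnP s) => [->|s0]; first by rewrite !muln0.
congr (_ * _)%N.
have <- : (\sum_(r < q | ~~ (s * q <= r * p)) 1 = (s * q %/ p).+1)%N.
  rewrite -[RHS]card_ord -sum1_card.
  rewrite (big_ord_widen q (fun=> 1%N)) ?quot_lt //.
  (* The conditions [r * p < s * q] and [r * p <= s * q] agree, since equality would give [p %| s]
     with [0 < s < p]. *)
  apply: eq_bigl => r; rewrite -ltnNge ltnS leq_divRL // ltn_neqAle.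
  case: eqVneq => //= E; exfalso.
  have : (p %| s * q)%N by rewrite -E dvdn_mull.
  by rewrite Gauss_dvdl // => /(dvdn_leq s0); rewrite leqNgt ltn_ord.
rewrite -[RHS]card_ord -sum1_card.
by rewrite [RHS](bigID (fun r : 'I_q => s * q <= r * p)%N).
Qed.

Lemma dedekind_sum_reciprocity (R : realType) (p q : nat) :
  (0 < p)%N -> (0 < q)%N -> coprime p q ->
  dedekind_sum R p%:Z q + dedekind_sum R q%:Z p =
  (p%:R ^+ 2 + q%:R ^+ 2 + 1) / (12 * p%:R * q%:R) + (p%:R + q%:R) / 4 - 3 / 4.
Proof.
move=> p0 q0 cop.
have P0 : (p%:R : R) != 0 by rewrite pnatr_eq0 -lt0n.
have Q0 : (q%:R : R) != 0 by rewrite pnatr_eq0 -lt0n.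
have modE a b r : ((r * a) %% b)%:R = r%:R * a%:R - b%:R * (r * a %/ b)%:R :> R.
  by rewrite -natrM {2}(divn_eq (r * a) b) natrD natrM; ring.
pose f (a b r : nat) : R := (r * a %/ b)%:R.
have sumE a b : (\sum_(r < b) r * ((r * a) %% b))%:R =
    a%:R * (\sum_(r < b) r%:R ^+ 2) - b%:R * \sum_(r < b) r%:R * f a b r :> R.
  rewrite natr_sum !mulr_sumr -sumrB; apply: eq_bigr => r _.
  by rewrite natrM modE /f; ring.
rewrite !dedekind_sumE // !sumE.
have H1 : p%:R * (\sum_(r < q) r%:R) - q%:R * (\sum_(r < q) f p q r)
    = \sum_(r < q) r%:R :> R.
  rewrite -[RHS](sum_perm_mod (fun r => r%:R) cop) !mulr_sumr -sumrB.
  by apply: eq_bigr => r _; rewrite modE /f; ring.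
have H2 : p%:R ^+ 2 * (\sum_(r < q) r%:R ^+ 2)
    - 2 * p%:R * q%:R * (\sum_(r < q) r%:R * f p q r)
    + q%:R ^+ 2 * (\sum_(r < q) f p q r ^+ 2) = \sum_(r < q) r%:R ^+ 2 :> R.
  rewrite -[RHS](sum_perm_mod (fun r => r%:R ^+ 2) cop) !mulr_sumr.
  rewrite -sumrB -big_split /=.
  by apply: eq_bigr => r _; rewrite modE /f; ring.
have H3 : \sum_(r < q) f p q r ^+ 2 + \sum_(r < q) f p q r
    + 2 * (\sum_(s < p) s%:R * f q p s + \sum_(s < p) s%:R)
    = 2 * q%:R * \sum_(s < p) s%:R :> R.
  have /(congr1 (GRing.natmul (1 : R))) := sum_lattice p0 q0 cop.
  rewrite natrD !natrM !natr_sum => <-.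
  rewrite -!big_split /=; congr (_ + 2 * _); apply: eq_bigr => r _;
    by rewrite natrM -natr1 /f; ring.
(* What remains is linear in four unknown sums: [H1] gives [F1], [H3] gives [F2] in terms of [G],
   and [H2] then gives [F]. The terms in [G] cancel between the two Dedekind sums. *)
move: H1 H2 H3; rewrite !sum_natr !sum_natr_sqr.
move: (\sum_(r < q) r%:R * _) (\sum_(r < p) r%:R * _) => F G.
move: (\sum_(r < q) f p q r ^+ 2) (\sum_(r < q) f p q r) => F2 F1.
move: (p%:R : R) (q%:R : R) P0 Q0 => P Q P0 Q0 H1 H2 H3.
have F1E : F1 = (P - 1) * (Q - 1) / 2.
  by apply: (mulfI Q0); lra.
have F2E : F2 = (Q - 1) * P * (P - 1) - F1 - 2 * G by lra.
have -> : F = ((P ^+ 2 - 1) * (Q * (Q - 1) * (2 * Q - 1) / 6) + Q ^+ 2 * F2)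
    / (2 * P * Q).
  apply: (mulIf (_ : 2 * P * Q != 0)); first by rewrite !mulf_neq0 ?pnatr_eq0.
  rewrite divfK; last by rewrite !mulf_neq0 ?pnatr_eq0.
  by lra.
by rewrite F2E F1E; field; rewrite P0 Q0.
Qed.

(** Subtract reciprocity for [(p, c)] from that for [(p, q)]: the sums with modulus [p] agree by
    periodicity. Coprimality of [p] and [c] is returned to limit the residues of [p] mod [c]. *)
Lemma dedekind_sum_congr (R : realType) (p q c : nat) :
  (0 < p)%N -> (0 < q)%N -> (0 < c)%N -> coprime p q -> (q = c %[mod p])%N ->
  coprime p c /\
  dedekind_sum R p%:Z q =
    (p%:R ^+ 2 + q%:R ^+ 2 + 1) / (12 * p%:R * q%:R) + q%:R / 4
    - (p%:R ^+ 2 + c%:R ^+ 2 + 1) / (12 * p%:R * c%:R) - c%:R / 4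
    + dedekind_sum R p%:Z c.
Proof.
move=> p0 q0 c0 cop E.
have copc : coprime p c by rewrite -coprime_modr -E coprime_modr.
split=> //; have := dedekind_sum_reciprocity R p0 q0 cop.
have := dedekind_sum_reciprocity R p0 c0 copc.
by rewrite (dedekind_sum_mod R p0 E); lra.
Qed.

Theorem theorem2 (R : realType) (p q : nat)
    (hp : (0 < p)%N) (hpq : (p < q)%N) (hcop : coprime p q) :
  let P : R := p%:R in
  let Q : R := q%:R in
  [/\ (q = 1 %[mod p])%N ->
        dedekind_sum R p%:Z q =
          (P ^+ 2 + Q ^+ 2 + 1) / (12 * P * Q) + Q / 4
          - P / 12 - 1 / (6 * P) - 1 / 4,
      (q = 2 %[mod p])%N ->
        dedekind_sum R p%:Z q =
          (P ^+ 2 + Q ^+ 2 + 1) / (12 * P * Q) + Q / 4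
          - P / 24 - 5 / (24 * P) - 1 / 4,
      (q = 3 %[mod p])%N ->
        dedekind_sum R p%:Z q =
          (P ^+ 2 + Q ^+ 2 + 1) / (12 * P * Q) + Q / 4
          - P / 36 - 5 / (18 * P) - 1 / 3 * frac_part (P / 3) - 1 / 12
    & (q = 4 %[mod p])%N ->
        dedekind_sum R p%:Z q =
          (P ^+ 2 + Q ^+ 2 + 1) / (12 * P * Q) + Q / 4
          - P / 48 - 17 / (48 * P) - 1 / 2 * frac_part (P / 4)].
Proof.
move=> P Q; have q0 : (0 < q)%N := ltn_trans hp hpq.
have P0 : P != 0 by rewrite pnatr_eq0 -lt0n.
have Q0 : Q != 0 by rewrite pnatr_eq0 -lt0n.
split.
- move=> /(dedekind_sum_congr R hp q0 (ltn0Sn 0) hcop)[_ ->].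
  rewrite (dedekind_sumE_mod _ _ (ltn0Sn 0)) big_nat1 -/P -/Q mul0n.
  by field; rewrite P0 Q0.
- move=> /(dedekind_sum_congr R hp q0 (ltn0Sn 1) hcop)[c ->].
  have m : (p %% 2)%N = 1%N by rewrite modn2; move: c; rewrite coprimen2 => ->.
  rewrite (dedekind_sumE_mod _ _ (ltn0Sn 1)) m.
  do 2![rewrite big_ltn //]; rewrite big_geq // -/P -/Q.
  by rewrite (_ : (_ + _)%N = 1%N) //; field; rewrite P0 Q0.
- move=> /(dedekind_sum_congr R hp q0 (ltn0Sn 2) hcop)[c ->].
  rewrite frac_part_div // (dedekind_sumE_mod _ _ (ltn0Sn 2)).
  do 3![rewrite big_ltn //]; rewrite big_geq // -/P -/Q.
  have : coprime (p %% 3) 3 by rewrite coprime_modl.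
  have := ltn_pmod p (ltn0Sn 2).
  (* Coprimality excludes residue 0. Residues 1 and 2 give the numerators 1 + 4 = 5 and 2 + 2 = 4
     over 9. *)
  case: (p %% 3)%N => [|[|[|m]]] //= _ _.
    by rewrite (_ : (_ + _)%N = 5%N) //; field; rewrite P0 Q0.
  by rewrite (_ : (_ + _)%N = 4%N) //; field; rewrite P0 Q0.
- move=> /(dedekind_sum_congr R hp q0 (ltn0Sn 3) hcop)[c ->].
  rewrite frac_part_div // (dedekind_sumE_mod _ _ (ltn0Sn 3)).
  do 4![rewrite big_ltn //]; rewrite big_geq // -/P -/Q.
  have : coprime (p %% 4) 4 by rewrite coprime_modl.
  have := ltn_pmod p (ltn0Sn 3).
  (* Only the odd residues 1 and 3 survive, with numerators 1 + 4 + 9 = 14 and 3 + 4 + 3 = 10 over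
     16. *)
  case: (p %% 4)%N => [|[|[|[|m]]]] //= _ _.
    by rewrite (_ : (_ + _)%N = 14%N) //; field; rewrite P0 Q0.
  by rewrite (_ : (_ + _)%N = 10%N) //; field; rewrite P0 Q0.
Qed.
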